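(* For every $n\ge1$, the homology of the ordered partition poset $\Pi_O(n)$ with coefficients in $k$ is the $\mathbb{S}_n$-module $$H_l(\Pi_O(n))\cong\begin{cases}k[\mathbb{S}_n]&\text{if } l=n-1,\\0&\text{otherwise.}\end{cases}$$
   Context: $k$ denotes $\mathbb{Z}$, $\mathbb{Q}$, $\mathbb{F}_p$ or a field of characteristic $0$. An ordered partition of $[n]$ is a set of linearly ordered sequences of elements of $[n]$ giving a set partition of $[n]$ after forgetting the orders. In $\Pi_O(n)$, $\lambda\le\mu$ iff each block of $\lambda$ is the concatenation of an ordered sequence of blocks of $\mu$; minimal elements are $\{(\tau(1),\dots,\tau(n))\}$, $\tau\in\mathbb{S}_n$, maximal element $\{(1),\dots,(n)\}$; $\mathbb{S}_n$ acts by relabelling. $H_l(\Pi)$ is the homology of the complex spanned by chains $\lambda_0<\cdots<\lambda_l$ with $\lambda_0$ minimal and $\lambda_l$ maximal, differential $\sum_{0<i<l}(-1)^id_i$, $d_i$ omitting $\lambda_i$. $k[\mathbb{S}_n]$ is the regular representation. *)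

(* Defs.v *)
From HB Require Import structures.
From mathcomp Require Import all_boot all_order all_fingroup all_algebra.
Set Implicit Arguments. Unset Strict Implicit. Unset Printing Implicit Defensive.
Import GRing.Theory.
Local Open Scope ring_scope.

Definition char0_field (k : comNzRingType) : Prop :=
  (forall x : k, x != 0 -> exists y : k, x * y = 1) /\
  (forall m : nat, (0 < m)%N -> m%:R != 0 :> k).

Definition coeff_ok (k : comNzRingType) : Prop :=
  bijective (fun z : int => z%:~R : k)
  \/ (exists p : nat, prime p /\ exists f : {rmorphism 'F_p -> k}, bijective f)
  \/ char0_field k.

(* ---------- Blocks: nonempty linearly ordered subsets of [n] ---------- *)
Fixpoint words (n m : nat) : seq (seq 'I_n) :=
  if m is m'.+1 then [::] :: [seq x :: w | x <- enum 'I_n, w <- words n m']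
  else [:: [::]].

Definition blocks_enum (n : nat) : seq (seq 'I_n) :=
  [seq s <- undup (words n n) | (s != [::]) && uniq s].

Definition Block (n : nat) : finType := seq_sub (blocks_enum n).

Definition OP (n : nat) : finType := {set Block n}.

Definition is_ordpart (n : nat) (P : OP n) : Prop :=
  (forall x : 'I_n, exists2 b, b \in P & x \in val b) /\
  (forall (b1 b2 : Block n) (x : 'I_n), b1 \in P -> b2 \in P ->
      x \in val b1 -> x \in val b2 -> b1 = b2).

Definition op_le (n : nat) (lam mu : OP n) : Prop :=
  forall b, b \in lam ->
    exists s : seq (Block n), all (fun c => c \in mu) s /\
                              val b = flatten (map (fun c : Block n => val c) s).

Definition op_lt (n : nat) (lam mu : OP n) : Prop := op_le lam mu /\ lam <> mu.

Definition op_minimal (n : nat) (lam : OP n) : Prop :=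
  is_ordpart lam /\ forall mu, is_ordpart mu -> op_le mu lam -> mu = lam.

Definition op_maximal (n : nat) (lam : OP n) : Prop :=
  is_ordpart lam /\ forall mu, is_ordpart mu -> op_le lam mu -> mu = lam.

Definition is_chain (n l : nat) (c : l.+1.-tuple (OP n)) : Prop :=
  (forall i : 'I_l.+1, is_ordpart (tnth c i)) /\
  (forall i : nat, (i < l)%N -> op_lt (nth set0 c i) (nth set0 c i.+1)) /\
  op_minimal (nth set0 c 0) /\ op_maximal (nth set0 c l).

(* C_l : k-valued functions on (l+1)-tuples supported on chains of length l
   (= free k-module on the chains) *)
Definition supported_on_chains (k : comNzRingType) (n l : nat)
  (f : {ffun l.+1.-tuple (OP n) -> k}) : Prop :=
  forall c, f c != 0 -> is_chain c.

Definition delete (T : Type) (i : nat) (s : seq T) : seq T :=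
  take i s ++ drop i.+1 s.

(* differential  d = sum_{0<i<l} (-1)^i d_i  from C_l to C_{l-1} *)
Definition bd (k : comNzRingType) (n l : nat)
  (f : {ffun l.+1.-tuple (OP n) -> k}) : {ffun l.-tuple (OP n) -> k} :=
  [ffun c' : l.-tuple (OP n) =>
     \sum_(c : l.+1.-tuple (OP n))
       \sum_(1 <= i < l) ((-1) ^+ i * f c) *+ (delete i (val c) == val c')].

Definition cycle_l (k : comNzRingType) (n l : nat)
  (f : {ffun l.+1.-tuple (OP n) -> k}) : Prop :=
  supported_on_chains f /\ bd f = 0.

Definition boundary_l (k : comNzRingType) (n l : nat)
  (f : {ffun l.+1.-tuple (OP n) -> k}) : Prop :=
  exists2 g : {ffun l.+2.-tuple (OP n) -> k}, supported_on_chains g & f = bd g.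

Definition relabel_block (n : nat) (s : 'S_n) (b : Block n) : Block n :=
  insubd b (map s (val b)).

Definition relabel_op (n : nat) (s : 'S_n) (P : OP n) : OP n :=
  [set relabel_block s b | b in P].

Definition act_chainfun (k : comNzRingType) (n l : nat) (s : 'S_n)
  (f : {ffun l.+1.-tuple (OP n) -> k}) : {ffun l.+1.-tuple (OP n) -> k} :=
  [ffun c => f (map_tuple (relabel_op (s^-1)%g) c)].

Definition act_reg (k : comNzRingType) (n : nat) (s : 'S_n)
  (g : {ffun 'S_n -> k}) : {ffun 'S_n -> k} :=
  [ffun t => g (s * t)%g].

(* H_l(Pi_O(n)) = Z_l / B_l is isomorphic to k[S_n] as a k[S_n]-module:
   there is a k-linear S_n-equivariant map on Z_l onto k[S_n] with kernel B_l *)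
Definition homology_iso_regular (k : comNzRingType) (n l : nat) : Prop :=
  exists phi : {ffun l.+1.-tuple (OP n) -> k} -> {ffun 'S_n -> k},
    [/\ (forall (a : k) (f g : {ffun l.+1.-tuple (OP n) -> k}), cycle_l f -> cycle_l g ->
           phi [ffun c => a * f c + g c] = [ffun t => a * phi f t + phi g t]),
        (forall (s : 'S_n) (f : {ffun l.+1.-tuple (OP n) -> k}), cycle_l f -> phi (act_chainfun s f) = act_reg s (phi f)),
        (forall h, exists2 f, cycle_l f & phi f = h) &
        (forall f : {ffun l.+1.-tuple (OP n) -> k}, cycle_l f -> (phi f = 0 <-> boundary_l f))].

Definition homology_zero (k : comNzRingType) (n l : nat) : Prop :=
  forall f : {ffun l.+1.-tuple (OP n) -> k}, cycle_l f -> boundary_l f.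

(* Main.v *)
(* Above the minimal element (w), an ordered partition is determined by the set of
   pairs of letters adjacent in one of its blocks, which can be any set of pairs of
   consecutive letters of w; refinement is reverse inclusion. The chain complex
   is therefore a direct sum, over the words w, of chain complexes of Boolean
   lattices of rank n-1, and S_n permutes the summands simply transitively.

   For a Boolean lattice, fix an element a. Modulo boundaries a cycle can be
   supported on chains that remove a alone. On such a cycle, exchanging the step
   that removes a with its predecessor changes the sign, so the cycle is determined
   by its values on chains removing a first, which form a cycle of the Boolean
   lattice without a. By induction homology is concentrated in top degree, where
   a cycle is determined by its value on one maximal chain. The differential of
   the exterior algebra provides a cycle with value 1 or -1 on that chain. *)

Require Import Defs.
From mathcomp Require Import all_boot all_order all_fingroup all_algebra.
Set Implicit Arguments. Unset Strict Implicit. Unset Printing Implicit Defensive.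
Import GRing.Theory.
Local Open Scope ring_scope.

(** * Acyclicity of Boolean lattices below the top degree *)

Section SeqBoundary.
Variables (T : finType) (V : zmodType).
Implicit Types (f g : seq T -> V) (s t : seq T).

(** Dual form of the differential: the value at [s] gathers the values of [f] at the sequences
    obtained by inserting an entry before position [i], with sign [(-1)^i]. Nothing is inserted at
    the end, since chains end at a fixed element. *)
Fixpoint seq_bd f s : V :=
  if s is y :: t then \sum_z f (z :: y :: t) - seq_bd (fun u => f (y :: u)) t
  else 0.

Lemma eq_seq_bd f g : f =1 g -> seq_bd f =1 seq_bd g.
Proof.
move=> eq_fg s; elim: s f g eq_fg => //= y t IHt f g eq_fg.
by congr (_ - _); [apply: eq_bigr | apply: IHt].
Qed.

Lemma seq_bd_eq0 f : (forall s, f s = 0) -> forall s, seq_bd f s = 0.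
Proof.
move=> f0 s; elim: s f f0 => //= y t IHt f f0.
by rewrite big1 // IHt ?subr0.
Qed.

Lemma seq_bdD f g s : seq_bd (fun t => f t + g t) s = seq_bd f s + seq_bd g s.
Proof.
elim: s f g => /= [|y t IHt] f g; first by rewrite addr0.
by rewrite big_split IHt opprD addrACA.
Qed.

Lemma seq_bdN f s : seq_bd (fun t => - f t) s = - seq_bd f s.
Proof.
elim: s f => /= [|y t IHt] f; first by rewrite oppr0.
by rewrite sumrN IHt opprD.
Qed.

Lemma seq_bdB f g s : seq_bd (fun t => f t - g t) s = seq_bd f s - seq_bd g s.
Proof. by rewrite seq_bdD seq_bdN. Qed.

Lemma seq_bd_sum (I : finType) (F : I -> seq T -> V) s :
  seq_bd (fun t => \sum_i F i t) s = \sum_i seq_bd (F i) s.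
Proof.
elim: s F => /= [|y t IHt] F; first by rewrite big1.
by rewrite IHt sumrB exchange_big.
Qed.

(** Two insertions before the head cancel after exchanging the summation variables; an insertion
    before the head and one further on occur in both orders with opposite signs; the rest is the
    induction hypothesis. *)
Lemma seq_bd_seq_bd f s : seq_bd (seq_bd f) s = 0.
Proof.
elim: s f => //= y t IHt f.
rewrite seq_bdB IHt subr0 sumrB /= sumrB seq_bd_sum exchange_big /= opprB.
by rewrite addrCA subrr addr0 subrr.
Qed.

End SeqBoundary.

Lemma proper_setU1 (U : finType) (a : U) (x : {set U}) :
  a \notin x -> x \proper a |: x.
Proof. by move=> ax; rewrite properE subsetUr subUset sub1set (negPf ax). Qed.

Section SetChains.
Variables (U : finType) (V : zmodType).
Implicit Types (x y z : {set U}) (s t : seq {set U}).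
Implicit Types (f g : seq {set U} -> V).

(* A chain [x > y_1 > ... > y_l = set0] is recorded as its tail [y_1; ...; y_l]. *)
Fixpoint set_chain x s :=
  if s is y :: t then (y \proper x) && set_chain y t else x == set0.

Definition chain_supp x l f :=
  forall s, f s != 0 -> set_chain x s /\ size s = l.

Lemma chain_supp_behead x l f y :
  chain_supp x l.+1 f -> chain_supp y l (fun t => f (y :: t)).
Proof. by move=> fP t /fP[/= /andP[_ ->] [->]]. Qed.

Lemma chain_supp_proper x l f y t :
  chain_supp x l f -> ~~ (y \proper x) -> f (y :: t) = 0.
Proof.
move=> fP yx; apply/eqP; apply: contraNT yx.
by case/fP=> /= /andP[].
Qed.

Lemma chain_suppB x l f g : chain_supp x l f -> chain_supp x l g ->
  chain_supp x l (fun s => f s - g s).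
Proof.
move=> fP gP s; have [->|/fP//] := eqVneq (f s) 0.
by rewrite sub0r oppr_eq0 => /gP.
Qed.

Lemma chain_suppD x l f g : chain_supp x l f -> chain_supp x l g ->
  chain_supp x l (fun s => f s + g s).
Proof.
move=> fP gP s; have [->|/fP//] := eqVneq (f s) 0.
by rewrite add0r => /gP.
Qed.

Lemma seq_bd_supp0 x f s : chain_supp x 0 f -> seq_bd f s = 0.
Proof.
move=> fP; have f0 y t : f (y :: t) = 0 by apply/eqP/negP => /negP /fP[].
by case: s => //= y t; rewrite big1 ?seq_bd_eq0 ?subr0.
Qed.

Lemma seq_bd_supp x l f : chain_supp x l.+1 f -> chain_supp x l (seq_bd f).
Proof.
move=> fP s; elim: s l x f fP => [|y t IHt] l x f fP; first by rewrite eqxx.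
rewrite /=; have [fy0|[z fz0]] :
    (forall z, f (z :: y :: t) = 0) \/ exists z, f (z :: y :: t) != 0.
- case: (boolP [forall z, f (z :: y :: t) == 0]) => [/forallP h|].
    by left=> z; apply/eqP.
  by rewrite negb_forall => /existsP[z h]; right; exists z.
- rewrite big1 // sub0r oppr_eq0.
  have fyP : chain_supp y l (fun u => f (y :: u)) by apply: chain_supp_behead fP.
  case: l fP fyP => [|l] fP fyP; first by rewrite (seq_bd_supp0 _ fyP) eqxx.
  move=> h; have [-> ->] := IHt _ _ _ fyP h; split=> //.
  apply/andP; split=> //; apply: contraNT h => yx.
  by rewrite seq_bd_eq0 // => u; apply: chain_supp_proper fP yx.
- move=> _; have [/= /and3P[zx yz ->] [<-]] := fP _ fz0.
  by rewrite (proper_trans yz zx).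
Qed.

Section Removal.
Variable a : U.

(* In a chain from [x] with [a \in x], the element [a] gets removed at a unique
   step; [joint_removal] says that other elements are removed at that step. *)
Fixpoint joint_removal x s :=
  if s is y :: t then
    if a \in y then joint_removal y t else y != x :\ a
  else false.

(** Inserting [a |: y] just before the first [y] lacking [a] splits a joint removal into two steps,
    the second removing [a] alone. Joint chains are thus matched with longer chains, on which [g] is
    built. The two vanishing conditions on [g] keep corrections at different steps from disturbing
    one another in the induction. *)
Lemma kill_joint_removal l x f : a \in x -> chain_supp x l f ->
  exists g, [/\ chain_supp x l.+1 g,
                forall y t, a \notin y -> g (y :: t) = 0,
                forall s, joint_removal x s -> g s = 0 &
                forall s, joint_removal x s -> f s = seq_bd g s].
Proof.
elim: l x f => [|l IHl] x f ax fP.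
  exists (fun=> 0); split=> // [s|s js]; first by rewrite eqxx.
  rewrite seq_bd_eq0 //; apply/eqP/negP => /negP /fP[+ /size0nil s0].
  by rewrite s0 /= => /eqP x0; rewrite x0 inE in ax.
(* For chains removing [a] jointly in the first step, the value of [f] is moved to the chain refined
   by [a |: y]. The condition [z != x] rules out the lone removal [y = x :\ a]. *)
pose g0 s := if s is z :: y :: t then
  if [&& a \notin y, z == a |: y & z != x] then f (y :: t) else 0 else 0.
have g0P : chain_supp x l.+2 g0.
  case=> [|z [|y t]]; rewrite /= ?eqxx //.
  case: ifP => [/and3P[ay /eqP-> zx] /fP[/= /andP[yx ->] [->]]|]; last by rewrite eqxx.
  rewrite proper_setU1 // andbT; split=> //; rewrite properEneq zx subUset sub1set ax /=.
  by rewrite andbT proper_sub.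
have g0_head y t : a \notin y -> g0 (y :: t) = 0.
  case: t => //= z t ay; rewrite ifF //; apply/and3P => -[_ /eqP y_eq _].
  by rewrite y_eq setU11 in ay.
have g0_joint s : joint_removal x s -> g0 s = 0.
  case: s => // z s; have [az|az] := boolP (a \in z); last by rewrite g0_head.
  case: s => [|y t] //=; rewrite az; case: ifP => //= ay yz; rewrite ifF //.
  apply/andP => -[/eqP z_eq _]; move: yz.
  by rewrite z_eq setU1K ?eqxx ?ay.
have bd_g0 y t : a \notin y -> y != x :\ a -> seq_bd g0 (y :: t) = f (y :: t).
  move=> ay yx /=; rewrite [X in _ - X]seq_bd_eq0 ?subr0; last first.
    by move=> u; apply: g0_head.
  rewrite (bigD1 (a |: y)) //= ay eqxx big1 ?addr0.
    case: ifP => // /negbFE /eqP x_eq.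
    by rewrite -x_eq setU1K ?eqxx // in yx.
  by move=> z /negPf->.
(* [f2] vanishes on the chains just treated. In the other joint chains the removal comes later, so
   the tails after a first entry [y] containing [a] fall under the induction hypothesis. *)
pose f2 s := f s - seq_bd g0 s.
have f2P : chain_supp x l.+1 f2 by apply: chain_suppB (seq_bd_supp g0P).
have [g1 g1P] : exists g1 : {set U} -> seq {set U} -> V, forall y,
    [/\ chain_supp y l.+1 (g1 y), forall z t, a \notin z -> g1 y (z :: t) = 0,
        ~~ ((a \in y) && (y \proper x)) -> forall s, g1 y s = 0,
        forall s, joint_removal y s -> g1 y s = 0 &
        a \in y -> forall s, joint_removal y s -> f2 (y :: s) = seq_bd (g1 y) s].
  suff: forall y, exists h : seq {set U} -> V,
    [/\ chain_supp y l.+1 h, forall z t, a \notin z -> h (z :: t) = 0,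
        ~~ ((a \in y) && (y \proper x)) -> forall s, h s = 0,
        forall s, joint_removal y s -> h s = 0 &
        a \in y -> forall s, joint_removal y s -> f2 (y :: s) = seq_bd h s].
    exact: fin_all_exists.
  move=> y; have f2yP := @chain_supp_behead _ _ _ y f2P.
  case: (boolP ((a \in y) && (y \proper x))) => [/andP[ay yx]|nayx].
    by have [h [h1 h2 h3 h4]] := IHl _ _ ay f2yP; exists h; split.
  exists (fun=> 0); split=> // [s|ay s _]; first by rewrite eqxx.
  rewrite ay /= in nayx.
  by rewrite seq_bd_eq0 // (chain_supp_proper _ f2P).
(* The minus sign offsets the one in front of the tail term of [seq_bd]. *)
pose g2 s := if s is y :: t then - g1 y t else 0.
have g2P : chain_supp x l.+2 g2.
  case=> [|y t] /=; rewrite ?eqxx // oppr_eq0.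
  have [g1P1 _ g1P2 _ _] := g1P y.
  case: (boolP ((a \in y) && (y \proper x))) => [/andP[_ ->]|/g1P2->].
    by case/g1P1=> -> ->.
  by rewrite eqxx.
have g2_head y t : a \notin y -> g2 (y :: t) = 0.
  move=> ay /=; have [_ _ -> //] := g1P y; first by rewrite oppr0.
  by rewrite (negPf ay).
exists (fun s => g0 s + g2 s); split.
- exact: chain_suppD.
- by move=> y t ay; rewrite g0_head ?g2_head ?addr0.
- move=> s js; rewrite g0_joint // add0r; case: s js => //= y t.
  case: ifP => ay js; last by have := g2_head y t; rewrite /= ay => ->.
  by have [_ _ _ -> //] := g1P y; rewrite oppr0.
- case=> // y t jyt; rewrite seq_bdD; apply/eqP; rewrite addrC -subr_eq.
  rewrite -[X in X == _]/(f2 (y :: t)); apply/eqP.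
  move: jyt; rewrite [joint_removal _ _]/=; case: ifP => [ay jt|/negbT ay yx].
    rewrite /= big1 ?sub0r; last first.
      move=> z _; have [_ _ g1z0 g1zj _] := g1P z.
      have [az|az] := boolP (a \in z); last by rewrite g1z0 ?oppr0 // (negPf az).
      by rewrite g1zj ?oppr0 //= ay.
    by rewrite seq_bdN opprK; have [_ _ _ _ ->] := g1P y.
  rewrite /f2 bd_g0 // subrr /= big1; last first.
    by move=> z _; have [_ -> //] := g1P z; rewrite oppr0.
  by rewrite seq_bd_eq0 ?subr0 // => u; apply: g2_head.
Qed.

(* If only [a] is removed at the step where it disappears, the cycle condition
   transports values along exchanges of this step with the previous one. *)
Lemma lone_removal_cycle l x f : a \in x -> chain_supp x l f ->
    (forall s, joint_removal x s -> f s = 0) ->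
    (forall y t, a \notin y -> f (y :: t) = 0) ->
    (forall s, joint_removal x s -> seq_bd f s = 0) ->
  forall s, f s = 0.
Proof.
elim: l x f => [|l IHl] x f ax fP fj fh fbd s.
  apply/eqP/negP => /negP /fP[+ /size0nil s0].
  by rewrite s0 /= => /eqP x0; rewrite x0 inE in ax.
case: s => [|y t]; first by apply/eqP/negP => /negP /fP[].
have [ay|ay] := boolP (a \in y); last exact: fh.
have [yx|yx] := boolP (y \proper x); last exact: chain_supp_proper fP yx.
apply: (IHl y (fun u => f (y :: u))) => // [|u ju|z u az|u ju].
- exact: chain_supp_behead fP.
- by apply: fj; rewrite /= ay.
- have [z_eq|zy] := eqVneq z (y :\ a); last by apply: fj; rewrite /= ay (negPf az).
  (* Passing directly from [x] to [z] removes [a] jointly, so the cycle condition holds at [z :: u].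
     Among the entries that can be inserted before [z], only [y] makes the removal of [a] lone. *)
  have zx : z != x :\ a.
    apply: contraTneq yx => zx; rewrite -(setD1K ax) -zx z_eq setD1K //.
    by rewrite properxx.
  have := fbd (z :: u); rewrite [joint_removal _ _]/= (negPf az) => /(_ zx).
  rewrite /= [X in _ - X]seq_bd_eq0 ?subr0; last by move=> v; apply: fh.
  rewrite (bigD1 y) //= big1 ?addr0 // => w wy.
  have [aw|aw] := boolP (a \in w); last exact: fh.
  apply: fj; rewrite /= aw (negPf az); apply: contraNneq wy => zw.
  by rewrite -(setD1K aw) -zw z_eq setD1K.
- have := fbd (y :: u); rewrite [joint_removal _ _]/= ay => /(_ ju) /eqP.
  rewrite /= big1 ?sub0r ?oppr_eq0 => [/eqP //|z _].
  have [az|az] := boolP (a \in z); last exact: fh.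
  by apply: fj; rewrite /= az ay.
Qed.

End Removal.

(** The maximal chain on which top-degree cycles are tested. *)
Fixpoint removal_chain (e : seq U) : seq {set U} :=
  if e is _ :: e' then [set u in e'] :: removal_chain e' else [::].

(** The condition at [removal_chain e] only bites for [l = size e], so a single induction on [e]
    yields both acyclicity in the other degrees and the control of top-degree cycles by one
    value. *)
Lemma set_chain_acyclic (e : seq U) l f : uniq e -> chain_supp [set u in e] l f ->
    (forall s, seq_bd f s = 0) -> (l = size e -> f (removal_chain e) = 0) ->
  exists2 g, chain_supp [set u in e] l.+1 g & f =1 seq_bd g.
Proof.
elim: e l f => [|a e IHe] l f.
  move=> _ fP _ f0; exists (fun=> 0) => [s|s]; first by rewrite eqxx.
  rewrite seq_bd_eq0 //; apply/eqP/negP => /negP fs.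
  have [] := fP _ fs; case: s fs => [|y t] fs /=.
    by move=> _ l0; rewrite f0 ?eqxx in fs.
  rewrite set_nil.
  by rewrite properE sub0set andbF.
rewrite [uniq _]/= => /andP[ae ue]; rewrite set_cons.
set x' := [set u in e]; have ax' : a \notin x' by rewrite inE.
set x := a |: x'; have ax : a \in x by rewrite setU11.
have x'x : x' = x :\ a by rewrite setU1K.
move=> fP fbd f0.
case: l fP f0 => [|l] fP f0.
  exists (fun=> 0) => [s|s]; first by rewrite eqxx.
  rewrite seq_bd_eq0 //; apply/eqP/negP => /negP /fP[+ /size0nil s0].
  by rewrite s0 /= => /eqP x0; rewrite x0 inE in ax.
(* Nothing lies strictly between [x'] and [x], so at [x' :: t] the boundary has only its tail term:
   the values on chains starting with [x'] form a cycle of the smaller lattice. *)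
have between z : z \proper x -> x' \proper z -> False.
  move=> /proper_card zx /proper_card x'z.
  by move: zx; rewrite cardsU1 ax' add1n ltnS leqNgt x'z.
have bd_x' h m t : chain_supp x m h -> seq_bd h (x' :: t) = - seq_bd (fun u => h (x' :: u)) t.
  move=> hP; rewrite /= big1 ?sub0r // => z _; apply/eqP/negP => /negP /hP[/= /and3P[zx x'z]].
  by case: (between z).
have [g' g'P g'E] : exists2 g', chain_supp x' l.+1 g' & (fun t => f (x' :: t)) =1 seq_bd g'.
  apply: IHe => // [|s|l_eq]; first exact: chain_supp_behead fP.
    by apply/eqP; rewrite -oppr_eq0 -(bd_x' _ _ _ fP) fbd.
  by apply: f0; rewrite l_eq.
(* Prefixing the primitive [g'] with [x'] clears, modulo a boundary, all chains that remove [a]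
   alone first. *)
pose g1 s := if s is y :: t then if y == x' then - g' t else 0 else 0.
have g1P : chain_supp x l.+2 g1.
  case=> [|y t] /=; first by rewrite eqxx.
  have [->|_] := eqVneq y x'; last by rewrite eqxx.
  by rewrite oppr_eq0 => /g'P[-> ->]; rewrite proper_setU1.
pose f1 s := f s - seq_bd g1 s.
have f1P : chain_supp x l.+1 f1 by apply: chain_suppB (seq_bd_supp g1P).
have f1x' t : f1 (x' :: t) = 0.
  rewrite /f1 (bd_x' _ _ _ g1P) opprK /= eqxx (g'E t).
  by rewrite seq_bdN subrr.
have f1bd s : seq_bd f1 s = 0 by rewrite seq_bdB fbd seq_bd_seq_bd subrr.
(* Clearing the joint removals does not revive chains starting with [x'], because [g2] vanishes when
   the head lacks [a]. *)
have [g2 [g2P g2h g2j f1E]] := kill_joint_removal ax f1P.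
have f2 s : f1 s - seq_bd g2 s = 0.
  move: s; apply: (lone_removal_cycle ax) => [|s js|y t ay|s js].
  - exact: chain_suppB (seq_bd_supp g2P).
  - by rewrite f1E // subrr.
  - have [->|yx'] := eqVneq y x'.
      rewrite f1x' (bd_x' _ _ _ g2P) seq_bd_eq0 ?oppr0 ?addr0 // => u.
      exact: g2h.
    by rewrite f1E ?subrr //= (negPf ay) -x'x.
  - by rewrite seq_bdB f1bd seq_bd_seq_bd subrr.
exists (fun s => g1 s + g2 s); first exact: chain_suppD.
by move=> s; rewrite seq_bdD; apply/eqP; rewrite addrC -subr_eq -subr_eq0 f2.
Qed.

Lemma set_chain_size x s : set_chain x s -> (size s <= #|x|)%N.
Proof.
elim: s x => //= y t IHt x /andP[/proper_card yx /IHt].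
by move=> h; apply: leq_ltn_trans yx.
Qed.

End SetChains.

(** * The fundamental cycle of a Boolean lattice *)

Lemma seq_bdZ (T : finType) (k : comNzRingType) (a : k) (f : seq T -> k) s :
  seq_bd (fun t => a * f t) s = a * seq_bd f s.
Proof.
elim: s f => /= [|y t IHt] f; first by rewrite mulr0.
by rewrite IHt mulrBr big_distrr.
Qed.

Section FundamentalCycle.
Variables (U : finType) (k : comNzRingType).
Implicit Types (x y z : {set U}) (s t : seq {set U}).

Definition removal_rank (a : U) x := #|[set b in x | (enum_rank b < enum_rank a)%N]|.

(* The matrix of the Koszul differential on the exterior algebra over [U], hence
   of square zero. *)
Definition removal_sign x y : k :=
  \sum_(a in x | y == x :\ a) (-1) ^+ removal_rank a x.

Fixpoint removal_cycle x s : k :=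
  if s is y :: t then removal_sign x y * removal_cycle y t else (x == set0)%:R.

Lemma removal_rankD1 a b x : a \in x ->
  removal_rank b x = ((enum_rank a < enum_rank b) + removal_rank b (x :\ a))%N.
Proof.
move=> ax; rewrite /removal_rank (cardsD1 a) !inE ax /=; congr (_ + _)%N.
by apply: eq_card => c; rewrite !inE andbA.
Qed.

(** Removing [a] then [b], or [b] then [a], leads to the same set with opposite signs: removing the
    element of lower rank first lowers by one the exponent of the other, while the reverse order
    does not. *)
Lemma removal_sign_sqr0 x y : \sum_z removal_sign x z * removal_sign z y = 0.
Proof.
pose term a b : k := (-1) ^+ removal_rank a x * (-1) ^+ removal_rank b (x :\ a).
pose P a b := [&& a \in x, b \in x & y == x :\ a :\ b].
have -> : \sum_z removal_sign x z * removal_sign z y =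
    \sum_a \sum_(b | (a != b) && P a b) term a b.
  transitivity (\sum_z \sum_(a | (a \in x) && (z == x :\ a))
     \sum_(b | (a != b) && P a b) term a b).
    apply: eq_bigr => z _; rewrite big_distrl; apply: eq_bigr => a /andP[ax /eqP->].
    rewrite /removal_sign big_distrr /=; apply: eq_bigl => b.
    by rewrite !inE /P ax eq_sym -!andbA.
  rewrite (exchange_big_dep (mem x)) /=; last by move=> ? ? _ /andP[].
  rewrite [RHS](bigID (mem x)) /= [X in _ + X]big1 ?addr0; last first.
    by move=> a ax; rewrite big_pred0 // => b; rewrite /P (negPf (ax : a \notin x)) andbF.
  apply: eq_bigr => a ax; rewrite (big_pred1 (x :\ a)) // => z.
  by rewrite ax.
pose lt (a b : U) := (enum_rank a < enum_rank b)%N.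
transitivity (\sum_a \sum_(b | lt a b && P a b) term a b
            + \sum_a \sum_(b | lt b a && P a b) term a b).
  rewrite -big_split; apply: eq_bigr => a _ /=.
  rewrite (bigID (lt a)); congr (_ + _); apply: eq_bigl => b.
    rewrite andbAC; case ab: (lt a b); rewrite ?andbF //= andbT.
    by case: eqP ab => // ->; rewrite /lt ltnn.
  rewrite andbAC; congr (_ && _).
  by rewrite /lt -leqNgt ltn_neqAle (inj_eq val_inj) (inj_eq enum_rank_inj) eq_sym.
rewrite [X in _ + X](exchange_big_dep xpredT) //= -big_split big1 // => a _ /=.
rewrite [X in _ + X](eq_bigl (fun b => lt a b && P a b)); last first.
  move=> b; congr (_ && _); rewrite /P andbCA; congr [&& _, _ & _ == _].
  by rewrite !setDDl setUC.
rewrite -big_split big1 //= => b /andP[ab /and3P[ax bx _]].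
rewrite /term -!exprD (removal_rankD1 b ax) (removal_rankD1 a bx).
move: ab; rewrite /lt => ab; rewrite ab ltnNge (ltnW ab) /= add0n add1n.
by rewrite addSn exprS mulN1r [(removal_rank b _ + _)%N]addnC subrr.
Qed.

(** Insertions before the head sum to an entry of the squared Koszul matrix. *)
Lemma seq_bd_removal_cycle x s : seq_bd (removal_cycle x) s = 0.
Proof.
elim: s x => //= y t IHt x.
rewrite seq_bdZ IHt mulr0 subr0.
under eq_bigr do rewrite mulrA.
by rewrite -mulr_suml removal_sign_sqr0 mul0r.
Qed.

Lemma removal_sign_neq0 x y : removal_sign x y != 0 -> exists2 a, a \in x & y = x :\ a.
Proof.
move=> sxy; case: (pickP [pred a | (a \in x) && (y == x :\ a)]) => [a /andP[ax /eqP ya]|noa].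
  by exists a.
by rewrite /removal_sign big_pred0 ?eqxx in sxy.
Qed.

Lemma removal_cycle_supp x : chain_supp x #|x| (removal_cycle x).
Proof.
move=> s; elim: s x => [|y t IHt] x /=.
  by have [->|_] := eqVneq x set0; rewrite ?cards0 ?eqxx.
move=> nz; have sxy : removal_sign x y != 0.
  by apply: contraNneq nz => ->; rewrite mul0r.
have ryt : removal_cycle y t != 0.
  by apply: contraNneq nz => ->; rewrite mulr0.
have [a ax y_eq] := removal_sign_neq0 sxy; have [-> ->] := IHt _ ryt.
by rewrite y_eq properD1 //= [in RHS](cardsD1 a) ax.
Qed.

(** Exactly one element contributes at each step of the removal chain, so the value is a product of
    signs. Its square suffices for normalisation, whatever the sign is. *)
Lemma removal_cycle_sqr e : uniq e ->
  removal_cycle [set u in e] (removal_chain e) ^+ 2 = 1.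
Proof.
elim: e => /= [|a e IHe]; first by rewrite set_nil eqxx expr1n.
case/andP=> ae /IHe; rewrite exprMn => ->; rewrite mulr1 /removal_sign.
have ae' : a \notin [set u in e] by rewrite inE.
rewrite (big_pred1 a) => [|b]; first by rewrite -exprM mulnC exprM sqrrN !expr1n.
rewrite set_cons !inE /=; apply/idP/eqP => [/andP[b_in /eqP e_eq]|->]; last first.
  by rewrite eqxx setU1K ?eqxx.
apply/eqP; apply: contraNT ae' => ba.
by rewrite e_eq !inE eqxx eq_sym ba.
Qed.

End FundamentalCycle.

(** * Cutting a word into blocks *)

Section CutWords.
Variable T : finType.
Implicit Types (A B : {set T * T}) (w b : seq T) (s r : seq (seq T)) (p : T * T).

Definition pairs w := zip w (behead w).

Lemma mem_pairs_cons p x y w :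
  (p \in pairs (x :: y :: w)) = (p == (x, y)) || (p \in pairs (y :: w)).
Proof. by []. Qed.

Lemma mem_pairs1 p w : p \in pairs w -> p.1 \in w.
Proof.
elim: w => [|x [|y w] IHw] //; rewrite inE => /orP[/eqP->|/IHw h].
  by rewrite mem_head.
by rewrite inE h orbT.
Qed.

Lemma mem_pairs_cat p w1 w2 :
  (p \in pairs w1) || (p \in pairs w2) -> p \in pairs (w1 ++ w2).
Proof.
elim: w1 => [|x [|y w1] IHw] //=; first by case: w2 {IHw} => //= y w2; rewrite inE => ->; rewrite orbT.
by rewrite !inE -orbA => /orP[->//|/IHw h]; apply/orP; right.
Qed.

Lemma mem_pairs_flatten p b s : b \in s -> p \in pairs b -> p \in pairs (flatten s).
Proof.
elim: s => //= c s IHs; rewrite inE => /orP[/eqP<-|/IHs h] pb; apply: mem_pairs_cat.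
  by rewrite pb.
by rewrite h ?orbT.
Qed.

Lemma uniq_pairs w : uniq w -> uniq (pairs w).
Proof.
elim: w => [|x [|y w] IHw] // /andP[xw /IHw/= ->]; rewrite andbT.
by apply: contra xw => /(mem_pairs1 (w := y :: w)).
Qed.

Lemma size_pairs w : size (pairs w) = (size w).-1.
Proof. by rewrite size_zip size_behead; apply/minn_idPr/leq_pred. Qed.

Lemma pairs_map (T' : Type) (h : T -> T') w :
  zip (map h w) (behead (map h w)) = [seq (h p.1, h p.2) | p <- pairs w].
Proof. by elim: w => [|x [|y w] IHw] //=; congr (_ :: _). Qed.

(* Splits [x :: w] between consecutive letters that do not form a pair in [A];
   the result is the tail of the block of [x] together with the other blocks. *)
Fixpoint cut_from A x w : seq T * seq (seq T) :=
  if w is y :: w' then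
    let: (b, r) := cut_from A y w' in
    if (x, y) \in A then (y :: b, r) else ([::], (y :: b) :: r)
  else ([::], [::]).

Definition cut_word A w : seq (seq T) :=
  if w is x :: w' then let: (b, r) := cut_from A x w' in (x :: b) :: r else [::].

Lemma cut_wordE A x y w : cut_word A (x :: y :: w) =
  if cut_word A (y :: w) is b :: r then
    if (x, y) \in A then (x :: b) :: r else [:: x] :: b :: r
  else [::].
Proof. by rewrite /=; case: cut_from => b r; case: ifP. Qed.

Lemma cut_word_cons A x w : exists b r, cut_word A (x :: w) = (x :: b) :: r.
Proof. by rewrite /=; case: cut_from => b r; exists b, r. Qed.

Lemma flatten_cut_word A w : flatten (cut_word A w) = w.
Proof.
elim: w => [|x [|y w] IHw] //; rewrite cut_wordE.
have [b [r E]] := cut_word_cons A y w; move: IHw; rewrite E /= => <-.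
by case: ifP.
Qed.

Lemma cut_word_nnil A w b : b \in cut_word A w -> b != [::].
Proof.
elim: w b => [|x [|y w] IHw] b //; first by rewrite inE => /eqP->.
rewrite cut_wordE; have [c [r E]] := cut_word_cons A y w; rewrite E.
case: ifP => _; rewrite inE => /orP[/eqP->//|h]; apply: IHw; rewrite E //.
by rewrite inE h orbT.
Qed.

Lemma mem_pairs_cut_word A w p : uniq w ->
  has (fun b => p \in pairs b) (cut_word A w) = (p \in A) && (p \in pairs w).
Proof.
elim: w => [|x [|y w] IHw] uw; rewrite ?andbF //.
rewrite cut_wordE; move: uw => /andP[xw /IHw {IHw}].
have [b [r E]] := cut_word_cons A y w; rewrite E => /= IHw.
rewrite mem_pairs_cons; move: IHw; have [->|pxy] := eqVneq p (x, y) => IHw.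
  case: ifP => xyA /=; first by rewrite mem_pairs_cons eqxx.
  by rewrite IHw xyA.
by rewrite -IHw; case: ifP => //= _; rewrite mem_pairs_cons (negPf pxy).
Qed.

(** Blocks are recovered from their concatenation and the pairs inside them. If the first letter is
    alone in its block, uniqueness keeps it out of the other blocks, so its pair with the next
    letter is not in [A]. *)
Lemma cut_word_flatten A s :
    uniq (flatten s) -> (forall b, b \in s -> b != [::]) ->
    (forall p, p \in pairs (flatten s) ->
       (p \in A) = has (fun b => p \in pairs b) s) ->
  cut_word A (flatten s) = s.
Proof.
move Ew: (flatten s) => w; elim: w s Ew => [|x w IHw] s Ew uw s0 sA.
  case: s Ew s0 {sA} => // b s Ew s0; have := s0 b; rewrite inE eqxx.
  by case: b Ew {s0} => //= _ /(_ isT).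
case: s Ew s0 sA => // -[|z b] s; first by move=> _ /(_ [::]); rewrite inE => /(_ isT).
move=> /= [-> {z} Ew] s0 sA; case: w IHw Ew uw sA => [|y w] IHw Ew uw sA.
  have [b0 fs0] : b = [::] /\ flatten s = [::] by case: (b) Ew.
  have s_nil : s = [::].
    case: s s0 fs0 {Ew sA} => // -[|? ?] // s /(_ [::]).
    by rewrite !inE => /(_ isT).
  by rewrite b0 s_nil.
rewrite -/(cut_word A (x :: y :: w)) cut_wordE; case/andP: (uw) => xw uw'.
have pxy p : p \in pairs (y :: w) -> p != (x, y).
  by move/mem_pairs1; apply: contraTneq => ->.
case: b Ew s0 sA => [|y' b] Ew s0 sA; rewrite /= in Ew.
  rewrite (IHw s) //; last 2 first.
  - by move=> b bs; apply: s0; rewrite inE bs orbT.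
  - by move=> p pw; rewrite sA // inE pw orbT.
  case: s Ew s0 sA => // b s Ew s0 sA.
  rewrite (sA (x, y)) ?inE ?eqxx // ifN //; apply: contra xw => /hasP[c cs xyc].
  by rewrite -Ew; apply/flattenP; exists c => //; apply: mem_pairs1 xyc.
case: Ew => y'y Ew; rewrite {y'}y'y in s0 sA *.
rewrite (IHw ((y :: b) :: s)) /= ?Ew //.
- by rewrite sA ?inE eqxx.
- move=> c; rewrite inE => /orP[/eqP->//|cs]; apply: s0.
  by rewrite inE cs orbT.
- by move=> p pw; rewrite sA /= inE ?pw ?orbT // (negPf (pxy p pw)).
Qed.

(** [ss] groups the blocks of the finer cut by the coarser block containing them. A new first letter
    joins the first block, opens a block in the first group, or opens a new group. *)
Lemma cut_word_refine A B w : B \subset A ->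
  exists ss, map flatten ss = cut_word A w /\ flatten ss = cut_word B w.
Proof.
move=> BA; elim: w => [|x [|y w] [ss [ssA ssB]]]; first by exists [::].
  by exists [:: [:: [:: x]]].
rewrite !cut_wordE.
have [b [r E]] := cut_word_cons A y w; have [c [q F]] := cut_word_cons B y w.
rewrite {}E in ssA *; rewrite {}F in ssB *.
case: ss ssA ssB => [|[|d s1] ss] //= [<- <-] [-> <-].
case: ifP => xyA; case: ifP => xyB.
- by exists (((x :: y :: c) :: s1) :: ss).
- by exists (([:: x] :: (y :: c) :: s1) :: ss).
- by rewrite (subsetP BA _ xyB) in xyA.
- by exists ([:: [:: x]] :: ((y :: c) :: s1) :: ss).
Qed.

Lemma cut_word_full w : w != [::] -> uniq w -> cut_word [set p in pairs w] w = [:: w].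
Proof.
move=> w0 uw; have := @cut_word_flatten [set p in pairs w] [:: w].
rewrite /= cats0; apply=> // [b|p pw]; first by rewrite inE => /eqP->.
by rewrite inE pw.
Qed.

Lemma uniq_flatten_inj s b c x : uniq (flatten s) ->
  b \in s -> c \in s -> x \in b -> x \in c -> b = c.
Proof.
elim: s => //= d s IHs; rewrite cat_uniq => /and3P[_ /hasPn dis us].
have dis' a : a \in s -> x \in a -> x \in d -> False.
  move=> as_ xa xd; suff /dis/negP : x \in flatten s by [].
  by apply/flattenP; exists a.
rewrite !inE => /orP[/eqP->|bs] /orP[/eqP->|cs] xb xc //; last exact: IHs.
- by case: (dis' c).
- by case: (dis' b).
Qed.

End CutWords.

(** * The intervals above minimal elements *)

Section OrderedPartitions.
Variable n : nat.
Implicit Types (w : seq 'I_n) (A B : {set 'I_n * 'I_n}) (lam mu : OP n) (b c : Block n).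

Lemma mem_words m w : (size w <= m)%N -> w \in words n m.
Proof.
elim: m w => [|m IHm] [|x w] //= /IHm ww.
by rewrite inE; apply/orP; right; apply/allpairsP; exists (x, w); rewrite mem_enum.
Qed.

Lemma block_exists w : w != [::] -> uniq w -> exists b, val b = w.
Proof.
move=> w0 uw; have wB : w \in blocks_enum n.
  rewrite mem_filter w0 uw mem_undup mem_words //.
  by rewrite -(card_uniqP uw) -[X in (_ <= X)%N]card_ord max_card.
by exists (SeqSub wB).
Qed.

Lemma blockP b : val b != [::] /\ uniq (val b).
Proof. by have := valP b; rewrite mem_filter => /andP[/andP[]]. Qed.

Definition full_word w := uniq w && (size w == n).

Lemma full_word_uniq w : full_word w -> uniq w. Proof. by case/andP. Qed.

Lemma mem_full_word w x : full_word w -> x \in w.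
Proof.
case/andP=> uw /eqP sw; have sub : {subset w <= enum 'I_n} by move=> z; rewrite mem_enum.
have [|_ ->] := uniq_min_size uw sub; first by rewrite size_enum_ord sw.
by rewrite mem_enum.
Qed.

Definition cut w A : OP n := [set b : Block n | val b \in cut_word A w].

Definition adj lam : {set 'I_n * 'I_n} :=
  [set p | [exists b in lam, p \in pairs (val b)]].

Definition pairset w : {set 'I_n * 'I_n} := [set p in pairs w].

Lemma adjP lam p : reflect (exists2 b, b \in lam & p \in pairs (val b)) (p \in adj lam).
Proof. by rewrite inE; apply: exists_inP. Qed.

Lemma cut_block w A (s : seq 'I_n) : uniq w -> s \in cut_word A w ->
  exists2 b, b \in cut w A & val b = s.
Proof.
move=> uw sA; have us : uniq s.
  have := uw; rewrite -(flatten_cut_word A w).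
  elim: (cut_word A w) sA => //= t r IHr; rewrite cat_uniq inE.
  by case/orP=> [/eqP-> /and3P[]|/IHr h /and3P[_ _ /h]].
have [b b_s] := block_exists (cut_word_nnil sA) us.
by exists b; rewrite // inE b_s.
Qed.

Lemma cut_ordpart w A : full_word w -> is_ordpart (cut w A).
Proof.
move=> fw; have uw := full_word_uniq fw; split=> [x|b c x].
  have := mem_full_word x fw; rewrite -{1}(flatten_cut_word A w) => /flattenP[s sA xs].
  by have [b bA b_s] := cut_block uw sA; exists b; rewrite // b_s.
rewrite !inE => bA cA xb xc; apply: val_inj.
by apply: (uniq_flatten_inj (s := cut_word A w)) xb xc; rewrite ?flatten_cut_word.
Qed.

Lemma adj_cut w A : full_word w -> adj (cut w A) = A :&: pairset w.
Proof.
move=> fw; have uw := full_word_uniq fw; apply/setP=> p.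
rewrite in_setI [p \in pairset w]inE -mem_pairs_cut_word //.
apply/adjP/hasP => [[b]|[s sA ps]]; first by rewrite inE => bA pb; exists (val b).
by have [b bA b_s] := cut_block uw sA; exists b; rewrite // b_s.
Qed.

Lemma adj_cut_id w A : full_word w -> A \subset pairset w -> adj (cut w A) = A.
Proof. by move=> fw /setIidPl AD; rewrite adj_cut. Qed.

(** The block of [lam] containing the first letter of the pair is a concatenation of blocks of [mu];
    by disjointness, the one with that letter is the block in which the pair is adjacent. *)
Lemma op_le_adj lam mu : is_ordpart lam -> is_ordpart mu -> op_le lam mu ->
  adj mu \subset adj lam.
Proof.
move=> [cov _] [_ dis] le; apply/subsetP => p /adjP[b b_mu pb]; apply/adjP.
have xb := mem_pairs1 pb; have [c c_lam xc] := cov p.1.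
have [s [/allP s_mu c_eq]] := le _ c_lam; exists c => //.
have /flattenP[_ /mapP[b' b's ->] xb'] : p.1 \in flatten (map val s) by rewrite -c_eq.
have bb' : b = b' by apply: dis xb xb' => //; apply: s_mu.
by rewrite c_eq; apply: mem_pairs_flatten pb; rewrite bb'; apply: map_f.
Qed.

Lemma cut_le w A B : full_word w -> B \subset A -> op_le (cut w A) (cut w B).
Proof.
move=> fw BA b; rewrite inE; have uw := full_word_uniq fw.
have [ss [<- ssB]] := cut_word_refine w BA => /mapP[r r_ss ->].
have: {subset r <= cut_word B w} by move=> t tr; rewrite -ssB; apply/flattenP; exists r.
elim: r {r_ss} => [|t r IHr] sub /=; first by exists [::].
have [|s [s_cut ->]] := IHr; first by move=> u ur; apply: sub; rewrite inE ur orbT.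
have [c cB <-] := cut_block uw (sub t (mem_head _ _)).
by exists (c :: s); rewrite /= cB.
Qed.

Lemma op_le_trans lam mu nu : op_le lam mu -> op_le mu nu -> op_le lam nu.
Proof.
move=> le1 le2 b /le1[s [s_mu ->]]; elim: s s_mu => [|c s IHs] /=.
  by exists [::].
case/andP=> /le2[t [t_nu ->]] /IHs[r [r_nu ->]]; exists (t ++ r).
by rewrite all_cat t_nu r_nu map_cat flatten_cat.
Qed.

Lemma mem_cut_pairset w b : full_word w -> w != [::] ->
  (b \in cut w (pairset w)) = (val b == w).
Proof. by move=> fw w0; rewrite inE cut_word_full ?inE ?full_word_uniq. Qed.

(** [w] is a concatenation of blocks of [lam], and these are all its blocks, since [w] contains
    every letter and blocks are disjoint; [cut_word_flatten] then recovers them. *)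
Lemma cut_adj w lam : full_word w -> is_ordpart lam ->
  op_le (cut w (pairset w)) lam -> w != [::] -> lam = cut w (adj lam).
Proof.
move=> fw [cov dis] le w0; have uw := full_word_uniq fw.
have [bw bw_w] := block_exists w0 uw.
have [|s [/allP s_lam w_eq]] := le bw; first by rewrite mem_cut_pairset // bw_w.
rewrite bw_w in w_eq; have cut_s : cut_word (adj lam) w = map val s.
  rewrite w_eq cut_word_flatten // -?w_eq // => [b /mapP[c _ ->]|p pw].
    by case: (blockP c).
  apply/adjP/hasP => [[b b_lam pb]|[_ /mapP[c cs ->] pc]]; last first.
    by exists c => //; apply: s_lam.
  exists (val b) => //; have := mem_full_word p.1 fw.
  rewrite w_eq => /flattenP[_ /mapP[c cs ->] xc]; apply/mapP; exists c => //.
  by congr val; apply: dis (mem_pairs1 pb) xc => //; apply: s_lam.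
apply/setP=> b; rewrite inE cut_s (mem_map val_inj); apply/idP/idP => [b_lam|/s_lam//].
have [x xb] : exists x, x \in val b.
  by case: (val b) (blockP b) => [[]|x v _] //; exists x; rewrite mem_head.
have := mem_full_word x fw; rewrite w_eq => /flattenP[_ /mapP[c cs ->] xc].
by rewrite (dis b c x) // s_lam.
Qed.

(** Every ordered partition dominates the one whose single block concatenates its blocks in some
    order, so a minimal one has a single block. *)
Lemma op_minimal_cut lam : (0 < n)%N ->
  op_minimal lam <-> exists2 w, full_word w & lam = cut w (pairset w).
Proof.
move=> n0; have w_nnil w : full_word w -> w != [::].
  by case/andP=> _; apply: contraTneq => ->; rewrite /= neq_ltn n0.
split=> [[[cov dis] lam_min]|[w fw ->]].
  pose w := flatten (map val (enum lam)).
  have fw : full_word w.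
    have uw : uniq w.
      have: {subset enum lam <= lam} by move=> b; rewrite mem_enum.
      rewrite /w; elim: (enum lam) (enum_uniq lam) => //= b s IHs /andP[bs us] sub.
      rewrite cat_uniq IHs //; last by move=> c cs; apply: sub; rewrite inE cs orbT.
      have [_ ->] := blockP b; rewrite andbT; apply/hasPn => x /flattenP[_ /mapP[c cs ->] xc].
      apply: contra bs => xb; rewrite (dis b c x) // sub ?mem_head //.
      by rewrite inE cs orbT.
    rewrite /full_word uw /=; rewrite -(card_uniqP uw) -[X in _ == X]card_ord.
    apply/eqP/eq_card => x; rewrite [RHS]inE; apply/flattenP.
    by have [b b_lam xb] := cov x; exists (val b) => //; apply: map_f; rewrite mem_enum.
  exists w => //; apply/esym/lam_min; first exact: cut_ordpart.
  move=> b; rewrite mem_cut_pairset ?w_nnil // => /eqP->.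
  by exists (enum lam); split=> //; apply/allP => c; rewrite mem_enum.
split=> [|mu [cov _] le]; first exact: cut_ordpart.
have mu_w b : b \in mu -> val b = w.
  move=> /le[s [/allP s_cut b_eq]]; have [b0 ub] := blockP b.
  (* The block is a concatenation of copies of [w]; being nonempty without repeated letters, it is
     exactly one copy. *)
  have s_w : map val s = nseq (size s) w.
    rewrite -[size s](size_map val); apply/all_pred1P.
    apply/allP => _ /mapP[c cs ->] /=; rewrite -(mem_cut_pairset c fw) ?w_nnil //.
    exact: s_cut.
  case: s s_w {s_cut} b_eq => [|c [|d s]] s_w b_eq; first by rewrite b_eq in b0.
    by rewrite b_eq s_w /= cats0.
  move: ub; rewrite b_eq s_w /= cat_uniq => /and3P[_ /hasPn h _].
  by case: (w) (w_nnil _ fw) h => // x v _ /(_ x); rewrite mem_cat mem_head => /(_ isT)/negP[].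
apply/setP=> b; rewrite mem_cut_pairset ?w_nnil //; apply/idP/eqP => [/mu_w//|b_w].
(* A letter exists because [0 < n], so [mu] has a block. *)
have [c c_mu _] := cov (Ordinal n0); suff -> : b = c by [].
by apply: val_inj; rewrite b_w (mu_w c).
Qed.

Lemma op_maximal_cut w A : full_word w -> w != [::] -> A \subset pairset w ->
  op_maximal (cut w A) <-> A = set0.
Proof.
move=> fw w0 AD; split=> [[_ mx]|->].
  have := mx (cut w set0) (cut_ordpart _ fw) (cut_le fw (sub0set A)).
  by move/(congr1 adj); rewrite !adj_cut_id ?sub0set.
split=> [|mu mu_op le]; first exact: cut_ordpart.
rewrite (cut_adj fw mu_op _ w0); last exact: op_le_trans (cut_le fw (sub0set _)) le.
have := op_le_adj (cut_ordpart _ fw) mu_op le.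
by rewrite adj_cut_id ?sub0set // subset0 => /eqP->.
Qed.

End OrderedPartitions.

(** * Chains of ordered partitions *)

Lemma set_chain_sub (U : finType) (x : {set U}) s :
  set_chain x s -> all (fun y : {set U} => y \subset x) s.
Proof.
elim: s x => //= y t IHt x /andP[/proper_sub yx /IHt /allP yt]; rewrite yx /=.
by apply/allP => z /yt zy; apply: subset_trans zy yx.
Qed.

Lemma last_set_chain (U : finType) (x : {set U}) s : set_chain x s -> last x s = set0.
Proof. by elim: s x => [|y t IHt] x /= => [/eqP|/andP[_ /IHt]]. Qed.

Lemma set_chain_delete (U : finType) (x : {set U}) s i :
  set_chain x s -> (i.+1 < size s)%N -> set_chain x (delete i s).
Proof.
elim: s x i => // y t IHt x [|i] /= /andP[yx yt] it.
  case: t yt it {IHt} => //= z t /andP[zy ->] _; rewrite andbT.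
  exact: proper_trans zy yx.
by rewrite yx; apply: IHt.
Qed.

Lemma delete_insert (T : Type) i z (s : seq T) : (i <= size s)%N ->
  delete i (take i s ++ z :: drop i s) = s.
Proof.
elim: s i => [|x s IHs] [|i] si //=; rewrite /delete /= ?take0 ?drop0 //.
by congr (_ :: _); apply: IHs.
Qed.

Lemma insert_delete (T : Type) i z (s : seq T) : (i < size s)%N ->
  s = take i (delete i s) ++ nth z s i :: drop i (delete i s).
Proof.
elim: s i => [|x s IHs] [|i] si //=; first by rewrite /delete /= ?take0 ?drop0.
by congr (_ :: _); apply: IHs.
Qed.

Lemma size_insert (T : Type) i z (s : seq T) :
  size (take i s ++ z :: drop i s) = (size s).+1.
Proof. by rewrite size_cat /= addnS -size_cat cat_take_drop. Qed.

(** The explicit alternating sum, to be compared with [bd]. *)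
Lemma seq_bdE (T : finType) (k : comNzRingType) (f : seq T -> k) s :
  seq_bd f s =
  \sum_(0 <= i < size s) (-1) ^+ i * \sum_z f (take i s ++ z :: drop i s).
Proof.
elim: s f => [|y t IHt] f; first by rewrite big_geq.
rewrite /= IHt big_nat_recl // mul1r; congr (_ + _).
by rewrite -sumrN; apply: eq_bigr => i _; rewrite exprS mulN1r mulNr.
Qed.

Section Chains.
Variables (k : comNzRingType) (n : nat).
Hypothesis n_gt0 : (0 < n)%N.
Implicit Types (w : n.-tuple 'I_n) (S : seq {set 'I_n * 'I_n}).

Lemma full_tuple w : uniq w -> full_word w.
Proof. by rewrite /full_word size_tuple eqxx andbT. Qed.

Lemma tuple_nnil w : val w != [::].
Proof. by rewrite -size_eq0 size_tuple -lt0n. Qed.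

Definition cut_chain w S : seq (OP n) := cut w (pairset w) :: map (cut w) S.

Lemma size_cut_chain w S : size (cut_chain w S) = (size S).+1.
Proof. by rewrite /= size_map. Qed.

Lemma cut_chain_adj w S : uniq w -> set_chain (pairset w) S ->
  map (@adj n) (behead (cut_chain w S)) = S.
Proof.
move=> uw /set_chain_sub /allP sub; rewrite /= -map_comp.
by rewrite -[RHS]map_id; apply/eq_in_map => A /sub AD /=; rewrite adj_cut_id ?full_tuple.
Qed.

Lemma cut_pairset_inj w w' : uniq w -> uniq w' ->
  cut w (pairset w) = cut w' (pairset w') -> w = w'.
Proof.
move=> uw uw' E; have [b b_w] := block_exists (tuple_nnil w) uw.
have: b \in cut w (pairset w) by rewrite mem_cut_pairset ?b_w ?full_tuple ?tuple_nnil.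
rewrite E mem_cut_pairset ?full_tuple ?tuple_nnil // => /eqP b_w'.
by apply: val_inj; apply: etrans (esym b_w) b_w'.
Qed.

(** Minimality of the first entry supplies the word; every other entry lies above it, hence is a cut
    of that word. Cutting reverses order, and maximality of the last entry means that no pair is
    left. *)
Lemma is_chainP l (c : l.+1.-tuple (OP n)) : is_chain c <->
  exists w S, [/\ uniq w, set_chain (pairset w) S & val c = cut_chain w S].
Proof.
split=> [[c_op [c_lt [c_min c_max]]]|[w [S [uw SD c_eq]]]].
  have [w0 fw c0] := (op_minimal_cut _ n_gt0).1 c_min.
  have uw := full_word_uniq fw; have /andP[_ sw] := fw.
  pose w := Tuple sw; have w_nnil := tuple_nnil w; exists w.
  have c_op' : {in val c, forall lam, is_ordpart lam} by move=> _ /tnthP[i ->]; apply: c_op.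
  case: c {c_op} c_op' c_lt {c_min} c_max c0 => -[|lam t] //= st.
  have ->: l = size t by apply/eqP; rewrite -eqSS eq_sym.
  rewrite -[nth _ _ (size t)]/(nth set0 (lam :: t) (size (lam :: t)).-1) nth_last /=.
  move=> op lt mx lam_eq.
  suff [S_chain S_t] : set_chain (adj lam) (map (@adj n) t) /\ map (cut w0) (map (@adj n) t) = t.
    exists (map (@adj n) t); split=> //; last by rewrite /cut_chain S_t -lam_eq.
    by move: S_chain; rewrite {1}lam_eq adj_cut_id.
  (* Lying above the bottom element is carried through the induction, so that [cut_adj] applies to
     every entry. *)
  have: op_le (cut w0 (pairset w0)) lam by rewrite lam_eq; apply: cut_le.
  elim: t lam {lam_eq st} op lt mx => [|mu t IHt] lam op lt mx le.
    split=> //=; have lam_op : is_ordpart lam by apply: op; rewrite mem_head.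
    rewrite /= (cut_adj fw lam_op le w_nnil) in mx.
    apply/eqP/((op_maximal_cut fw w_nnil _).1 mx).
    by have := op_le_adj (cut_ordpart _ fw) lam_op le; rewrite adj_cut_id.
  have [le' neq] := lt 0%N isT; rewrite /= in le' neq.
  have lam_op : is_ordpart lam by apply: op; rewrite mem_head.
  have mu_op : is_ordpart mu by apply: op; rewrite inE mem_head orbT.
  have le_mu := op_le_trans le le'.
  have [|i|//|//|Sc St] := IHt mu.
  - by move=> nu nu_t; apply: op; rewrite inE nu_t orbT.
  - exact: (lt i.+1).
  rewrite /= Sc St -(cut_adj fw mu_op le_mu w_nnil) properEneq op_le_adj // andbT.
  split=> //; rewrite andbT; apply/eqP => adj_eq; apply: neq.
  by rewrite (cut_adj fw lam_op le) // -adj_eq -cut_adj.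
have fw := full_tuple uw; have sS : size S = l.
  by apply/eqP; rewrite -eqSS -(size_cut_chain w) -c_eq size_tuple.
split; last split; last split.
- move=> i; have := mem_tnth i c; rewrite -[_ \in c]/(_ \in val c) c_eq.
  by rewrite -[cut_chain w S]/(map (cut w) (_ :: S)) => /mapP[A _ ->]; apply: cut_ordpart.
- rewrite c_eq -sS -[cut_chain w S]/(map (cut w) (_ :: S)).
  elim: (S) {1 3 4 5}(pairset w) (subxx (pairset w)) SD => // B S' IHS A AD /= /andP[BA SB] [|i] iS.
    split; first by apply: cut_le => //; apply: proper_sub.
    have BD := subset_trans (proper_sub BA) AD.
    move=> /(congr1 (@adj n)); rewrite !adj_cut_id // => AB.
    by rewrite AB properxx in BA.
  by apply: IHS => //; apply: subset_trans (proper_sub BA) AD.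
- by apply/op_minimal_cut => //; exists w; rewrite ?c_eq.
- rewrite c_eq -sS -[cut_chain w S]/(map (cut w) (_ :: S)).
  rewrite -(size_map (cut w) S) -[size _]/((size (map (cut w) (pairset w :: S))).-1).
  rewrite nth_last /= last_map (last_set_chain SD).
  by apply/op_maximal_cut; rewrite ?sub0set ?tuple_nnil.
Qed.

Lemma cut_chain_inj w w' S S' : uniq w -> uniq w' ->
  set_chain (pairset w) S -> set_chain (pairset w') S' ->
  cut_chain w S = cut_chain w' S' -> w = w' /\ S = S'.
Proof.
move=> uw uw' SD SD' E; split; first by apply: cut_pairset_inj => //; case: E.
by rewrite -(cut_chain_adj uw SD) E cut_chain_adj.
Qed.

(** * Decomposition of the chain complex over words *)

Definition tuple_ext (T : finType) l (f : {ffun l.-tuple T -> k}) (s : seq T) : k :=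
  oapp f 0 (insub s).

Lemma tuple_ext_val (T : finType) l (f : {ffun l.-tuple T -> k}) c :
  tuple_ext f (val c) = f c.
Proof. by rewrite /tuple_ext valK. Qed.

(** The component of [f] in the summand of [w], in Boolean coordinates. The guard is needed because
    [cut w] forgets pairs outside [pairset w]. *)
Definition slice l (f : {ffun l.-tuple (OP n) -> k}) w S : k :=
  if set_chain (pairset w) S then tuple_ext f (cut_chain w S) else 0.

Lemma slice_supp l (f : {ffun l.+1.-tuple (OP n) -> k}) w :
  chain_supp (pairset w) l (slice f w).
Proof.
move=> S; rewrite /slice /tuple_ext; case: ifP; last by rewrite eqxx.
by case: insubP => [c /eqP|_]; rewrite ?eqxx //= size_map => -[->].
Qed.

Lemma sliceE l (f : {ffun l.-tuple (OP n) -> k}) (c : l.-tuple (OP n)) w S :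
  set_chain (pairset w) S -> val c = cut_chain w S -> slice f w S = f c.
Proof. by move=> SD c_eq; rewrite /slice SD -c_eq tuple_ext_val. Qed.

Lemma eq_slice l (f g : {ffun l.+1.-tuple (OP n) -> k}) :
  supported_on_chains f -> supported_on_chains g ->
  (forall w, uniq w -> slice f w =1 slice g w) -> f = g.
Proof.
move=> fP gP fg; apply/ffunP => c.
have chain_eq : is_chain c -> f c = g c.
  case/is_chainP=> w [S [uw SD c_eq]].
  by rewrite -(sliceE f SD c_eq) -(sliceE g SD c_eq) fg.
have [fc|/fP//] := eqVneq (f c) 0.
have [gc|/gP//] := eqVneq (g c) 0.
by rewrite fc gc.
Qed.

Lemma bd_supp l (f : {ffun l.+2.-tuple (OP n) -> k}) :
  supported_on_chains f -> supported_on_chains (bd f).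
Proof.
move=> fP c'; rewrite ffunE => nz.
have [c [i [i1 il fc c_del]]] : exists c i, [/\ (0 < i)%N, (i < l.+1)%N, f c != 0
    & delete i (val c) = val c'].
  have /existsP[c /existsP[i /and4P[i1 fc c_del _]]] :
    [exists c : l.+2.-tuple (OP n), exists i : 'I_l.+1,
      [&& (0 < i)%N, f c != 0, delete i (val c) == val c' & true]].
    apply: contraNT nz; rewrite negb_exists => /forallP h.
    rewrite big1 // => c _; rewrite big_nat_cond big1 // => i /andP[/andP[i1 il] _].
    have := h c; rewrite negb_exists => /forallP /(_ (Ordinal il)) /=.
    have [->|fc] := eqVneq (f c) 0; first by rewrite mulr0 mul0rn.
    by rewrite i1 andbT /= => /negPf->; rewrite mulr0n.
  by exists c, i; split=> //; apply/eqP.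
have /is_chainP[w [S [uw SD c_eq]]] := fP _ fc.
have sS : size S = l.+1 by apply/eqP; rewrite -eqSS -(size_cut_chain w) -c_eq size_tuple.
case: i i1 il c_del => // i _ il c_del; apply/is_chainP.
exists w, (delete i S); split=> //; first by apply: set_chain_delete; rewrite ?sS.
by rewrite -c_del c_eq /delete /cut_chain /= map_cat map_take map_drop.
Qed.

(** Deleting an interior entry keeps the bottom, so only chains over the same word contribute.
    Recording a chain by its tail shifts indices by one, whence the sign. *)
Lemma bd_cut_chain l (f : {ffun l.+2.-tuple (OP n) -> k}) (c' : l.+1.-tuple (OP n)) w S :
    supported_on_chains f -> uniq w -> set_chain (pairset w) S -> val c' = cut_chain w S ->
  bd f c' = - seq_bd (slice f w) S.
Proof.
move=> fP uw SD c'_eq.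
have sS : size S = l by apply/eqP; rewrite -eqSS -(size_cut_chain w) -c'_eq size_tuple.
rewrite ffunE exchange_big big_add1 /= seq_bdE sS -sumrN.
apply: eq_big_nat => i /= il; have {}il : (i <= size S)%N by rewrite sS ltnW.
pose ins z := take i S ++ z :: drop i S.
have del z : delete i.+1 (cut_chain w (ins z)) = cut_chain w S.
  rewrite /cut_chain /delete /= -map_take -map_drop -map_cat.
  by rewrite -/(delete i (ins z)) delete_insert.
(* A tuple of the support that reduces to [c'] is matched with the single [z] that was inserted; the
   other tuples match none. *)
transitivity (- ((-1) ^+ i * \sum_(c : l.+2.-tuple (OP n))
    \sum_(z | set_chain (pairset w) (ins z) && (val c == cut_chain w (ins z))) f c)).
  rewrite mulr_sumr -sumrN; apply: eq_bigr => c _.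
  have [->|fc] := eqVneq (f c) 0; first by rewrite big1 ?mulr0 ?mul0rn ?oppr0.
  rewrite exprS mulN1r mulNr mulNrn; congr (- _).
  have [c_del|c_del] := eqP; last first.
    rewrite big_pred0 ?mulr0 // => z; apply/andP => -[_ /eqP c_eq]; apply: c_del.
    by rewrite c_eq del c'_eq.
  have /is_chainP[w' [S' [uw' SD' c_eq]]] := fP _ fc.
  have sS' : size S' = l.+1 by apply/eqP; rewrite -eqSS -(size_cut_chain w') -c_eq size_tuple.
  have iS' : (i < size S')%N by rewrite sS' ltnS -sS.
  have E : cut_chain w' (delete i S') = cut_chain w S.
    apply: etrans c'_eq; apply: etrans c_del.
    by rewrite c_eq /delete /cut_chain /= map_cat map_take map_drop.
  have w'w : w' = w by apply: cut_pairset_inj => //; case: E.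
  rewrite {w' uw'}w'w in SD' c_eq E.
  have delS' : delete i S' = S.
    rewrite -(cut_chain_adj uw SD) -E /= -map_comp -[LHS]map_id; apply/eq_in_map => A.
    move=> A_in /=; rewrite adj_cut_id ?full_tuple //; apply: (allP (set_chain_sub SD')).
    by move: A_in; rewrite mem_cat => /orP[/mem_take|/mem_drop].
  have S'_eq := insert_delete set0 iS'; rewrite delS' in S'_eq.
  rewrite (big_pred1 (nth set0 S' i)) ?mulr1n // => z.
  apply/andP/eqP => [[insD /eqP c_ins]|z_eq].
    have [_ S'_ins] := cut_chain_inj uw uw SD' insD (etrans (esym c_eq) c_ins).
    by rewrite S'_ins /ins nth_cat size_takel // ltnn subnn.
  by rewrite {}z_eq /ins -S'_eq SD' c_eq.
congr (- (_ * _)); rewrite (exchange_big_dep xpredT) //=; apply: eq_bigr => z _.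
rewrite /slice -/(ins z); case: ifP => insD /=; last by rewrite big_pred0.
have st : size (cut_chain w (ins z)) == l.+2 by rewrite size_cut_chain size_insert sS.
rewrite (big_pred1 (Tuple st)) => [|c]; last by [].
by rewrite -(tuple_ext_val f (Tuple st)).
Qed.

Lemma slice_bd l (f : {ffun l.+2.-tuple (OP n) -> k}) w S :
  supported_on_chains f -> uniq w -> slice (bd f) w S = - seq_bd (slice f w) S.
Proof.
move=> fP uw; have [SD|SD] := boolP (set_chain (pairset w) S); last first.
  have -> : slice (bd f) w S = 0 by rewrite /slice (negPf SD).
  apply/esym/eqP; rewrite oppr_eq0.
  by apply: contraNT SD => /(seq_bd_supp (@slice_supp _ f w))[].
have [sS|sS] := eqVneq (size S) l; last first.
  have -> : slice (bd f) w S = 0.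
    by apply/eqP; apply: contraNT sS => /(@slice_supp _ (bd f) w)[_ ->].
  apply/esym/eqP; rewrite oppr_eq0.
  by apply: contraNT sS => /(seq_bd_supp (@slice_supp _ f w))[_ ->].
have st : size (cut_chain w S) == l.+1 by rewrite size_cut_chain sS.
have E : val (Tuple st) = cut_chain w S by [].
by rewrite (sliceE _ SD E) (bd_cut_chain fP uw SD E).
Qed.

Lemma cycle_slice l (f : {ffun l.+1.-tuple (OP n) -> k}) : cycle_l f <->
  supported_on_chains f /\ forall w, uniq w -> forall S, seq_bd (slice f w) S = 0.
Proof.
(* In degree 0 there is no interior entry, so both differentials vanish. *)
case: l f => [|l] f.
  split=> [[fP _]|[fP _]]; split=> //.
    by move=> w _ S; apply: seq_bd_supp0 (@slice_supp _ f w).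
  by apply/ffunP => c; rewrite !ffunE big1 // => ? _; rewrite big_geq.
split=> -[fP f0]; split=> //.
  move=> w uw S; apply/eqP; rewrite -oppr_eq0 -slice_bd // f0 /slice /tuple_ext.
  by case: ifP => // _; case: insub => //= c; rewrite ffunE.
apply: eq_slice; first exact: bd_supp.
  by move=> c; rewrite ffunE eqxx.
move=> w uw S; rewrite slice_bd // f0 // oppr0 /slice /tuple_ext.
by case: ifP => // _; case: insub => //= c; rewrite ffunE.
Qed.

(** Inverse to slicing. By [cut_chain_inj] at most one word contributes, so the sum only selects
    it. *)
Definition glue l (g : n.-tuple 'I_n -> seq {set 'I_n * 'I_n} -> k) :
    {ffun l.+1.-tuple (OP n) -> k} :=
  [ffun c : l.+1.-tuple (OP n) => let S := map (@adj n) (behead (val c)) in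
    \sum_(w : n.-tuple 'I_n | [&& uniq w, set_chain (pairset w) S & val c == cut_chain w S]) g w S].

Lemma glue_supp l g : supported_on_chains (glue l g).
Proof.
move=> c; rewrite ffunE /= => nz; apply/is_chainP.
set S := map _ _ in nz.
have /existsP[w /and3P[uw SD /eqP c_eq]] :
    [exists w : n.-tuple 'I_n, [&& uniq w, set_chain (pairset w) S & val c == cut_chain w S]].
  apply: contraNT nz; rewrite negb_exists => /forallP h.
  by rewrite big_pred0 // => w; apply/negbTE/h.
by exists w, S.
Qed.

Lemma slice_glue l g w : uniq w -> chain_supp (pairset w) l (g w) ->
  slice (glue l g) w =1 g w.
Proof.
move=> uw gP S; have [SD|SD] := boolP (set_chain (pairset w) S); last first.
  by rewrite /slice (negPf SD); apply/esym/eqP; apply: contraNT SD => /gP[].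
have [sS|sS] := eqVneq (size S) l; last first.
  have -> : slice (glue l g) w S = 0.
    by apply/eqP; apply: contraNT sS => /(@slice_supp _ (glue l g) w)[_ ->].
  by apply/esym/eqP; apply: contraNT sS => /gP[_ ->].
have st : size (cut_chain w S) == l.+1 by rewrite size_cut_chain sS.
have E : val (Tuple st) = cut_chain w S by [].
rewrite (sliceE _ SD E) ffunE E cut_chain_adj //; cbv zeta; rewrite (big_pred1 w) // => w'.
apply/and3P/eqP => [[uw' SD' /eqP E']|->]; last by rewrite uw SD eqxx.
by have [] := cut_chain_inj uw uw' SD SD' E'.
Qed.

Lemma boundary_slice l (f : {ffun l.+1.-tuple (OP n) -> k}) : supported_on_chains f ->
    (forall w, uniq w -> exists2 g, chain_supp (pairset w) l.+1 g & slice f w =1 seq_bd g) ->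
  boundary_l f.
Proof.
move=> fP fbd.
have /fin_all_exists[g gP] w : exists g, uniq w ->
    chain_supp (pairset w) l.+1 g /\ slice f w =1 seq_bd g.
  have [uw|uw] := boolP (uniq w); last by exists (fun=> 0).
  by have [g gP gE] := fbd w uw; exists g.
(* On slices, [bd] is the negative of [seq_bd]. *)
pose g' w S := - g w S.
have g'P w : uniq w -> chain_supp (pairset w) l.+1 (g' w).
  by move=> /gP[gwP _] S; rewrite oppr_eq0 => /gwP.
exists (glue l.+1 g'); first exact: glue_supp.
apply: eq_slice => // [|w uw S]; first by apply: bd_supp; apply: glue_supp.
rewrite slice_bd //; last exact: glue_supp.
have /eq_seq_bd-> := slice_glue uw (g'P w uw).
by rewrite seq_bdN opprK; have [_ ->] := gP w uw.
Qed.

(** A word has only [n.-1] pairs, so no chain is long enough to have a nonzero boundary in this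
    degree. *)
Lemma boundary_top_eq0 l (f : {ffun l.+1.-tuple (OP n) -> k}) :
  (n <= l.+1)%N -> boundary_l f -> f = 0.
Proof.
move=> nl [g gP ->]; apply/ffunP => c; rewrite !ffunE big1 // => c' _.
suff -> : g c' = 0 by rewrite big1 // => i _; rewrite mulr0 mul0rn.
apply/eqP/negP => /negP /gP /is_chainP[w [S [uw SD c'_eq]]].
have sS : size S = l.+1 by apply/eqP; rewrite -eqSS -(size_cut_chain w) -c'_eq size_tuple.
have := set_chain_size SD; rewrite cardsE (card_uniqP (uniq_pairs uw)) size_pairs.
by rewrite size_tuple sS -ltnS prednK // ltnNge nl.
Qed.

(** * Words as permutations and the regular representation *)

Definition inv_word (s : 'S_n) : n.-tuple 'I_n := [tuple (s^-1)%g i | i < n].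

Lemma inv_word_uniq s : uniq (inv_word s).
Proof. by rewrite map_inj_uniq ?val_ord_tuple ?enum_uniq //; apply: perm_inj. Qed.

Lemma inv_word_inj : injective inv_word.
Proof.
move=> s t /(congr1 (fun w => tnth w)) st; apply: invg_inj; apply/permP => i.
by have := congr1 (@^~ i) st; rewrite !tnth_mktuple.
Qed.

Lemma inv_word_surj w : uniq w -> exists s, w = inv_word s.
Proof.
move=> /tuple_uniqP w_inj; exists (perm w_inj)^-1%g.
by apply: eq_from_tnth => i; rewrite tnth_mktuple invgK permE.
Qed.

(** The reason for the inverse in [inv_word]: relabelling by [s^-1] becomes left multiplication by
    [s], as in [act_reg]. *)
Lemma map_inv_word (s t : 'S_n) :
  map (s^-1)%g (inv_word t) = inv_word (s * t)%g.
Proof. by rewrite -map_comp; apply: eq_map => i /=; rewrite invMg permM. Qed.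

Lemma cut_word_map (r : 'S_n) (A B : {set 'I_n * 'I_n}) (w : seq 'I_n) :
    (forall p, (p \in A) = ((r p.1, r p.2) \in B)) ->
  cut_word B (map r w) = map (map r) (cut_word A w).
Proof.
move=> AB; elim: w => [|x [|y w] IHw] //.
rewrite -[map r (x :: _)]/(r x :: r y :: map r w) !cut_wordE.
rewrite -[r y :: _]/(map r (y :: w)) IHw.
have [b [q ->]] := cut_word_cons A y w.
by rewrite (AB (x, y)) /=; case: ifP.
Qed.

Lemma relabel_cut (r : 'S_n) (A B : {set 'I_n * 'I_n}) (w : seq 'I_n) :
    uniq w -> (forall p, (p \in A) = ((r p.1, r p.2) \in B)) ->
  relabel_op r (cut w A) = cut (map r w) B.
Proof.
move=> uw AB.
(* The default value of [insubd] is never reached: the relabelled word is again nonempty without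
   repetitions. *)
have val_relabel b : val (relabel_block r b) = map r (val b).
  have [b0 ub] := blockP b; rewrite val_insubd.
  have [||c <-] := @block_exists n (map r (val b)); last by rewrite (valP c).
    by case: (val b) b0.
  by rewrite map_inj_uniq //; apply: perm_inj.
apply/setP=> c; rewrite [RHS]inE (cut_word_map w AB); apply/imsetP/mapP.
  by case=> b; rewrite inE => bA ->; exists (val b); rewrite ?val_relabel.
case=> s sA c_s; have [b b_cut b_s] := cut_block uw sA.
by exists b => //; apply: val_inj; rewrite val_relabel b_s.
Qed.

(** The order of removal is read off positions in the word, not off an order on letters, so
    relabelling carries test chains to test chains and no sign enters the action. *)
Lemma relabel_cut_chain (r : 'S_n) w w' : uniq w -> map r w = w' ->
  map (relabel_op r) (cut_chain w (removal_chain (pairs w))) =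
  cut_chain w' (removal_chain (pairs w')).
Proof.
move=> uw rw; rewrite /cut_chain /pairset /pairs -rw pairs_map -/(pairs w).
have mapE e p : (p \in [set u in e]) =
    ((r p.1, r p.2) \in [set u in [seq (r q.1, r q.2) | q <- e]]).
  rewrite !inE (mem_map (f := fun q => (r q.1, r q.2))) //.
  by move=> [a b] [c d] [/perm_inj-> /perm_inj->].
rewrite /= (relabel_cut uw (mapE (pairs w))); congr (_ :: _).
rewrite -map_comp; elim: (pairs w) => //= a e IHe; congr (_ :: _) => //.
exact: relabel_cut uw (mapE e).
Qed.

Lemma removal_chain_set_chain (U : finType) (e : seq U) :
  uniq e -> set_chain [set u in e] (removal_chain e).
Proof.
elim: e => [|a e IHe] /=; first by rewrite set_nil.
by case/andP=> ae /IHe->; rewrite set_cons proper_setU1 // inE.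
Qed.

Definition top_coef l (f : {ffun l.-tuple (OP n) -> k}) w : k :=
  slice f w (removal_chain (pairs w)).

Lemma top_coefE l (f : {ffun l.-tuple (OP n) -> k}) w : uniq w ->
  top_coef f w = tuple_ext f (cut_chain w (removal_chain (pairs w))).
Proof.
by move=> uw; rewrite /top_coef /slice (removal_chain_set_chain (uniq_pairs uw)).
Qed.

Lemma tuple_ext_act l (s : 'S_n) (f : {ffun l.+1.-tuple (OP n) -> k}) (t : seq (OP n)) :
  tuple_ext (act_chainfun s f) t = tuple_ext f (map (relabel_op s^-1) t).
Proof.
rewrite {1}/tuple_ext; case: insubP => [c _ <-|st] /=.
  by rewrite ffunE -(tuple_ext_val f).
by rewrite /tuple_ext insubN // size_map.
Qed.

Lemma cycle_boundary l (f : {ffun l.+1.-tuple (OP n) -> k}) : cycle_l f ->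
    (l = n.-1 -> forall w, uniq w -> top_coef f w = 0) ->
  boundary_l f.
Proof.
case/cycle_slice=> fP fbd ftop; apply: boundary_slice => // w uw.
apply: set_chain_acyclic; first exact: uniq_pairs.
- exact: slice_supp.
- exact: fbd.
- by rewrite size_pairs size_tuple => l_eq; apply: ftop.
Qed.

(** A top cycle is sent to its values at the test chains of all words. These determine it modulo
    boundaries, which are zero here, and multiples of the Koszul cycles glued over the words realise
    arbitrary values. *)
Lemma top_homology : homology_iso_regular k n n.-1.
Proof.
exists (fun f => [ffun s => top_coef f (inv_word s)]); split.
- move=> a f g _ _; apply/ffunP => s; rewrite !ffunE !top_coefE ?inv_word_uniq //.
  rewrite /tuple_ext; case: insub => /= [c|]; first by rewrite ffunE.
  by rewrite mulr0 addr0.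
- move=> s f _; apply/ffunP => t; rewrite !ffunE !top_coefE ?inv_word_uniq //.
  rewrite tuple_ext_act (relabel_cut_chain (inv_word_uniq t) (map_inv_word s t)) //.
(* The sum selects the one [s] with word [w]. The Koszul cycle has a value of square 1 at the test
   chain, so multiplying by that value normalises it there to 1. *)
- move=> h; pose g w S := (\sum_(s | inv_word s == w) h s) *
    removal_cycle k (pairset w) (removal_chain (pairs w)) * removal_cycle k (pairset w) S.
  have gP w : uniq w -> chain_supp (pairset w) n.-1 (g w).
    move=> uw S nz; have : removal_cycle k (pairset w) S != 0.
      by apply: contraNneq nz => c0; rewrite /g c0 mulr0.
    move/removal_cycle_supp; rewrite cardsE (card_uniqP (uniq_pairs uw)).
    by rewrite size_pairs size_tuple.
  exists (glue n.-1 g).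
    apply/cycle_slice; split=> [|w uw S]; first exact: glue_supp.
    have /eq_seq_bd-> := slice_glue uw (gP w uw).
    by rewrite seq_bdZ seq_bd_removal_cycle mulr0.
  apply/ffunP => s; rewrite ffunE /top_coef slice_glue ?inv_word_uniq //; last first.
    exact/gP/inv_word_uniq.
  rewrite /g -mulrA -expr2 removal_cycle_sqr ?uniq_pairs ?inv_word_uniq // mulr1.
  by rewrite (big_pred1 s) // => t; rewrite (inj_eq inv_word_inj).
- move=> f f_cyc; split=> [f0|f_bd].
    apply: cycle_boundary => // _ w /inv_word_surj[s ->].
    by move/ffunP/(_ s): f0; rewrite !ffunE.
  rewrite (boundary_top_eq0 _ f_bd) ?prednK //; apply/ffunP => s.
  rewrite !ffunE top_coefE ?inv_word_uniq // /tuple_ext.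
  by case: insub => //= c; rewrite ffunE.
Qed.

End Chains.

Theorem mainTheorem10 (k : comNzRingType) (hk : coeff_ok k) (n : nat) (hn : (0 < n)%N)
  (l : nat) :
  (l = n.-1 -> homology_iso_regular k n l) /\ (l <> n.-1 -> homology_zero k n l).
Proof.
split=> [->|l_neq]; first exact: top_homology.
(* Away from degree [n.-1] the condition on test chains is vacuous. *)
by move=> f f_cyc; apply: cycle_boundary.
Qed.
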